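(* Let $(L|K,v)$ be a Galois extension (possibly infinite) of henselian fields. Then $(L|K,v)$ is tame if and only if its Galois group $\mathrm{Gal}(L|K)$ is valuation independent.
   Context: Valuations are Krull valuations written additively. For a henselian field $(K,v)$, let $K^r$ be the fixed field, in the separable algebraic closure $K^{\rm sep}$, of the ramification group of $K^{\rm sep}|K$. An algebraic extension of $(K,v)$ is called tame if it lies in $K^r$; thus a Galois extension $(L|K,v)$ is tame if and only if its ramification group, i.e. the group of all $\sigma\in\mathrm{Gal}(L|K)$ such that $v\left(\frac{\sigma(d)}{d}-1\right)>0$ for all $d\in L^\times$, is trivial. For a Galois extension $(L|K,v)$ of henselian fields, let $\tilde L$ be the algebraic closure of $L$ and denote again by $v$ the unique extension of $v$ to $\tilde L$. The group $\mathrm{Gal}(L|K)$ is called valuation independent if for every $n\geq 1$, every choice of elements $d_1,\ldots,d_n\in\tilde L$ and every choice of pairwise distinct automorphisms $\sigma_1,\ldots,\sigma_n\in\mathrm{Gal}(L|K)$ there exists a nonzero element $d\in L$ such that $$v\sum_{i=1}^n\sigma_i(d)\,d_i\;=\;\min_{1\leq i\leq n}v\big(\sigma_i(d)\,d_i\big).$$ *)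

(* Defs.v *)
From HB Require Import structures.
From mathcomp Require Import all_boot all_order all_algebra all_field.

Set Implicit Arguments.
Unset Strict Implicit.
Unset Printing Implicit Defensive.

Import Order.TTheory GRing.Theory Num.Theory.
Local Open Scope ring_scope.

HB.mixin Record POrderedZmodule_isOrderedGroup V of Num.POrderedZmodule V := {
  ordered_group_le_total : total (<=%R : rel V);
  ordered_group_leD2r : forall x y z : V, x <= y -> x + z <= y + z
}.

#[short(type="orderedGroupType")]
HB.structure Definition OrderedGroup :=
  { V of Num.POrderedZmodule V & POrderedZmodule_isOrderedGroup V }.

Definition value (G : Type) : Type := option G.

Section Value.
Variable G : orderedGroupType.

Definition infty : value G := None.

HB.instance Definition _ := Choice.copy (value G) (option G).

Definition value_le (x y : value G) : bool :=
  match x, y with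
  | _, None => true
  | None, Some _ => false
  | Some a, Some b => a <= b
  end.

Lemma value_le_refl : reflexive value_le.
Proof. by case=> /=. Qed.

Lemma value_le_anti : antisymmetric value_le.
Proof. by case=> [a|] [b|] //= /le_anti->. Qed.

Lemma value_le_trans : transitive value_le.
Proof. by case=> [a|] [b|] [c|] //=; apply: le_trans. Qed.

Lemma value_le_total : total value_le.
Proof. by case=> [a|] [b|] //=; apply: ordered_group_le_total. Qed.

HB.instance Definition _ := Order.Le_isPOrder.Build ring_display (value G)
  value_le_refl value_le_anti value_le_trans.

HB.instance Definition _ :=
  Order.POrder_isTotal.Build ring_display (value G) value_le_total.

Definition value_add (x y : value G) : value G :=
  match x, y with
  | Some a, Some b => Some (a + b)
  | _, _ => None
  end.

Definition value0 : value G := Some 0.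

End Value.

Arguments value0 {G}.
Arguments infty {G}.

(* The value group of [v] is the subgroup of finite values; [v] need not be
   onto [G]. *)
Record valuation (F : fieldType) (G : orderedGroupType) := Valuation {
  valuation_fun :> F -> value G;
  valuation_eq_infty : forall x, valuation_fun x = infty <-> x = 0;
  valuationM : forall x y,
    valuation_fun (x * y) = value_add (valuation_fun x) (valuation_fun y);
  valuationD : forall x y,
    Order.min (valuation_fun x) (valuation_fun y) <= valuation_fun (x + y)
}.

Section Restriction.
Variables (F E : fieldType) (f : {rmorphism F -> E}) (G : orderedGroupType).
Variable v : valuation E G.

Lemma vrestrict_eq_infty x : v (f x) = infty <-> x = 0.
Proof.
split=> [/valuation_eq_infty/eqP|->]; first by rewrite fmorph_eq0 => /eqP.
by apply/valuation_eq_infty; rewrite rmorph0.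
Qed.

Lemma vrestrictM x y : v (f (x * y)) = value_add (v (f x)) (v (f y)).
Proof. by rewrite rmorphM valuationM. Qed.

Lemma vrestrictD x y : Order.min (v (f x)) (v (f y)) <= v (f (x + y)).
Proof. by rewrite rmorphD valuationD. Qed.

Definition vrestrict : valuation F G :=
  Valuation vrestrict_eq_infty vrestrictM vrestrictD.

End Restriction.

(* [v1] and [v2] have the same valuation ring. *)
Definition equivalent_valuations (F : fieldType) (G1 G2 : orderedGroupType)
    (v1 : valuation F G1) (v2 : valuation F G2) : Prop :=
  forall x, (value0 <= v1 x) = (value0 <= v2 x).

Definition extends_valuation (F E : fieldType) (f : {rmorphism F -> E})
    (G1 G2 : orderedGroupType) (w : valuation E G1) (v : valuation F G2) :=
  equivalent_valuations (vrestrict f w) v.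

(* A field extension is presented by the embedding [f] of its base field. *)
Section Extensions.
Variables (F E : fieldType) (f : {rmorphism F -> E}).

Definition algebraic_extension : Prop := forall x, algebraicOver f x.

(* Up to a scalar, [p] is the minimal polynomial of [x] over [F]. *)
Definition separable_extension : Prop :=
  forall x, exists p : {poly F},
    [/\ irreducible_poly p, root (map_poly f p) x & separable_poly p].

Definition normal_extension : Prop :=
  algebraic_extension /\
  forall p : {poly F}, irreducible_poly p ->
    (exists x, root (map_poly f p) x) ->
    exists rs : seq E, map_poly f p %= \prod_(z <- rs) ('X - z%:P).

Definition galois_extension : Prop :=
  normal_extension /\ separable_extension.

Definition separable_closure : Prop :=
  separable_extension /\
  forall p : {poly E}, separable_poly p -> (1 < size p)%N ->
    exists x, root p x.

Definition in_Gal (s : {rmorphism E -> E}) : Prop :=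
  bijective s /\ forall x, s (f x) = f x.

End Extensions.

(* [v] has a unique extension to every algebraic extension field of [F].
   Existence of an extension is automatic (Chevalley). *)
Definition henselian (F : fieldType) (G : orderedGroupType)
    (v : valuation F G) : Prop :=
  forall (E : fieldType) (f : {rmorphism F -> E}), algebraic_extension f ->
  forall (G1 G2 : orderedGroupType)
    (w1 : valuation E G1) (w2 : valuation E G2),
    extends_valuation f w1 v -> extends_valuation f w2 v ->
    equivalent_valuations w1 w2.

Definition in_ramification_group (F E : fieldType) (f : {rmorphism F -> E})
    (G : orderedGroupType) (v : valuation E G) (s : {rmorphism E -> E}) :=
  in_Gal f s /\ forall d : E, d != 0 -> value0 < v (s d / d - 1).

(* The elements of K^r, [f] being the embedding of K in K^sep. *)
Definition in_ramification_field (K Ksep : fieldType)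
    (f : {rmorphism K -> Ksep}) (G : orderedGroupType)
    (v : valuation Ksep G) (x : Ksep) : Prop :=
  forall s : {rmorphism Ksep -> Ksep}, in_ramification_group f v s -> s x = x.

Definition tame (K L Ksep : fieldType) (i : {rmorphism K -> L})
    (j : {rmorphism L -> Ksep}) (G : orderedGroupType)
    (v : valuation Ksep G) : Prop :=
  algebraic_extension i /\
  forall x : L, in_ramification_field (j \o i) v (j x).

(* [e] is the embedding of L in its algebraic closure [Lbar]. *)
Definition valuation_independent (K L Lbar : fieldType)
    (i : {rmorphism K -> L}) (e : {rmorphism L -> Lbar})
    (G : orderedGroupType) (v : valuation Lbar G) : Prop :=
  forall (n : nat) (d_ : 'I_n -> Lbar) (s : 'I_n -> {rmorphism L -> L}),
    (0 < n)%N ->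
    (forall a, in_Gal i (s a)) ->
    (forall a b, s a =1 s b -> a = b) ->
    exists2 d : L, d != 0 &
      v (\sum_(a < n) e (s a d) * d_ a) =
      \big[Order.min/infty]_(a < n) v (e (s a d) * d_ a).

(* Main.v *)
(* Both properties are equivalent to the triviality of the ramification group
   Ram(L|K).
   Restriction to L maps Ram(K^sep|K) onto Ram(L|K).  For surjectivity, an
   element [s] of Ram(L|K) extends to K^sep so as to act trivially on any
   finite set of residues (by Gauss's lemma applied to a product over
   conjugates); a power prime to the residue characteristic
   of this extension kills the residue characters [d |-> t d / d] on a given
   finite set, and such a power moves whatever [s] moves.  Compactness of the
   Galois group then yields an element of Ram(K^sep|K).
   Since [v] is Galois invariant, [d |-> s d / d mod M] is a character with
   values in the residue field, and Ram(L|K) = 1 makes these characters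
   distinct for distinct [s]; Artin's independence of characters is then
   valuation independence.  Conversely, a nontrivial [s] in Ram(L|K) violates
   it for the pair [1, s] with coefficients [1, -1]. *)
Require Import Defs.
From HB Require Import structures.
From mathcomp Require Import all_boot all_order all_algebra separable fieldext.
From mathcomp Require boolp classical_sets filter.

Set Implicit Arguments.
Unset Strict Implicit.
Unset Printing Implicit Defensive.

Import Order.TTheory GRing.Theory.
Local Open Scope ring_scope.

(** * Valuation rings and one-units *)

Section Valuation.
Variables (F : fieldType) (G : orderedGroupType) (v : valuation F G).
Implicit Types x y z : F.

Definition val_ring : pred F := fun x => value0 <= v x.
Definition val_max : pred F := fun x => value0 < v x.

Lemma value_add0 (a : value G) : value_add value0 a = a.
Proof. by case: a => [a|] //=; rewrite add0r. Qed.

Lemma value_addC : commutative (@value_add G).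
Proof. by case=> [a|] [b|] //=; rewrite addrC. Qed.

Lemma value_leD2r (a b c : value G) : a <= b -> value_add a c <= value_add b c.
Proof.
by case: a b c => [a|] [b|] [c|] //; apply: ordered_group_leD2r.
Qed.

Lemma value_leD2rE (a b c : value G) :
  c != infty -> (value_add a c <= value_add b c) = (a <= b).
Proof.
move=> cN; apply/idP/idP; last exact: value_leD2r.
case: c cN => [c|] // _ /(value_leD2r (Some (- c))).
by case: a b => [a|] [b|] //=; rewrite !addrK.
Qed.

Lemma valuation0 : v 0 = infty.
Proof. exact/valuation_eq_infty. Qed.

Lemma valuation_neq_infty x : (v x != infty) = (x != 0).
Proof. by congr (~~ _); apply/eqP/eqP => /(valuation_eq_infty v). Qed.

Lemma valuation1 : v 1 = value0.
Proof.
have := valuationM v 1 1; rewrite mulr1.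
have := valuation_neq_infty 1; rewrite oner_eq0; case: (v 1) => [a|] //= _.
by case=> /esym/eqP; rewrite -subr_eq0 addrK => /eqP->.
Qed.

(** Comparing [a] with [0] and translating by [a] gives both inequalities. This yields
    [v (-1) = value0], since the double of that value is zero. *)
Lemma ordered_group_double_eq0 (a : G) : a + a = 0 -> a = 0.
Proof.
move=> aa; apply: le_anti.
have := ordered_group_le_total a 0 => /orP[] H;
  have := ordered_group_leD2r _ _ a H; rewrite aa add0r => H';
  by rewrite H H'.
Qed.

Lemma valuationN x : v (- x) = v x.
Proof.
suff vN1 : v (-1) = value0 by rewrite -mulN1r valuationM vN1 value_add0.
have := valuationM v (-1) (-1); rewrite mulrNN mulr1 valuation1.
case: (v (-1)) => [a|] //= [] /esym /ordered_group_double_eq0 ->.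
by [].
Qed.

Lemma val_ring_subring : subring_closed val_ring.
Proof.
split=> [|x y|x y]; rewrite !unfold_in /val_ring.
- by rewrite valuation1.
- move=> xO yO.
  by apply: le_trans (valuationD v x (- y)); rewrite le_min valuationN xO.
- move=> xO yO; rewrite valuationM; apply: le_trans yO _.
  by rewrite -[X in X <= _]value_add0 value_leD2r.
Qed.

HB.instance Definition _ :=
  GRing.isSubringClosed.Build F val_ring val_ring_subring.

Lemma val_max_zmod : zmod_closed val_max.
Proof.
split=> [|x y]; rewrite !unfold_in /val_max; first by rewrite valuation0.
move=> xO yO.
by apply: lt_le_trans (valuationD v x (- y)); rewrite lt_min valuationN xO.
Qed.

HB.instance Definition _ := GRing.isZmodClosed.Build F val_max val_max_zmod.

Lemma val_maxW x : x \in val_max -> x \in val_ring.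
Proof. by rewrite !unfold_in; apply: ltW. Qed.

Lemma val_maxPn x : x \in val_ring -> (x \in val_max) = (v x != value0).
Proof.
by rewrite !unfold_in /val_ring /val_max lt_neqAle eq_sym => ->; rewrite andbT.
Qed.

Lemma unit_val_ring x : v x = value0 -> x \in val_ring.
Proof. by rewrite unfold_in /val_ring => ->. Qed.

Lemma unit_notin_max x : v x = value0 -> x \notin val_max.
Proof. by rewrite unfold_in /val_max => ->; rewrite ltxx. Qed.

Lemma val_maxM x y : x \in val_ring -> y \in val_max -> x * y \in val_max.
Proof.
rewrite !unfold_in /val_max /val_ring valuationM => xO yM.
apply: lt_le_trans yM _.
by rewrite -[X in X <= _]value_add0 value_leD2r.
Qed.

Lemma val_maxMr x y : x \in val_max -> y \in val_ring -> x * y \in val_max.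
Proof. by move=> xM yO; rewrite mulrC val_maxM. Qed.

Lemma val_max_prime x y : x \in val_ring -> y \in val_ring ->
  x * y \in val_max -> (x \in val_max) || (y \in val_max).
Proof.
move=> xO yO; rewrite !val_maxPn ?rpredM // valuationM.
apply: contraNT; rewrite negb_or !negbK => /andP[/eqP-> /eqP->].
by rewrite value_add0.
Qed.

Lemma unitM_max x y : v x = value0 -> (x * y \in val_max) = (y \in val_max).
Proof. by move=> vx; rewrite !unfold_in /val_max valuationM vx value_add0. Qed.

Lemma valuation_unitD x y : v x = value0 -> y \in val_max -> v (x + y) = value0.
Proof.
move=> vx yM; have xyO : x + y \in val_ring.
  by apply: rpredD; [apply: unit_val_ring | apply: val_maxW].
apply/eqP; rewrite -[_ == _]negbK -val_maxPn //.
by rewrite rpredDr // unit_notin_max.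
Qed.

Lemma val_max_pow x n : x \in val_ring -> x ^+ n \in val_max -> x \in val_max.
Proof.
move=> xO; elim: n => [|n IHn].
  by rewrite expr0 (negPf (unit_notin_max valuation1)).
by rewrite exprS => /val_max_prime/orP[]; rewrite ?rpredX.
Qed.

Lemma one_unit_valuation x : x - 1 \in val_max -> v x = value0.
Proof. by move=> /(valuation_unitD valuation1); rewrite addrC subrK. Qed.

(** In residue characteristic [p] the power [(x - 1) ^+ p] is congruent to [x ^+ p - 1], because the
    inner binomial coefficients are divisible by [p]; and the maximal ideal is radical. *)
Lemma one_unit_prime_power p x : prime p -> p%:R \in val_max ->
  v x = value0 -> x ^+ p - 1 \in val_max -> x - 1 \in val_max.
Proof.
move=> pp pM vx xp; set e := x - 1.
have eO : e \in val_ring by rewrite rpredB ?rpred1 ?unit_val_ring.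
apply: (@val_max_pow _ p) => //.
have -> : e ^+ p = (x ^+ p - 1) -
    \sum_(i < p.-1) 1 ^+ (p - i.+1) * e ^+ i.+1 *+ 'C(p, i.+1).
  have -> : x ^+ p = (1 + e) ^+ p by rewrite addrC subrK.
  rewrite [(1 + e) ^+ _]exprDn; case: p pp {pM xp} => // p pp.
  rewrite big_ord_recl big_ord_recr /= subn0 expr1n bin0 mul1r expr0 mulr1n.
  rewrite /bump /= add1n subnn binn expr0 mul1r mulr1n.
  by rewrite [1 + _]addrC addrK [_ + e ^+ _]addrC addrK.
rewrite rpredB // rpred_sum // => k _; rewrite expr1n mul1r.
have kp : (0 < k.+1 < p)%N by case: p pp k {pM xp} => // p _ k /=; rewrite ltnS.
have /dvdnP[c ->] := prime_dvd_bin pp kp.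
by rewrite mulrnA -mulr_natr val_maxM // rpredMn // rpredX.
Qed.

Lemma valuationX_eq0 x n : v x = value0 -> v (x ^+ n) = value0.
Proof.
move=> vx; elim: n => [|n IHn]; first by rewrite expr0 valuation1.
by rewrite exprS valuationM vx value_add0.
Qed.

(* [m] is the prime-to-p part of [n], p being the residue characteristic. *)
Lemma unit_root_prime_part n : (0 < n)%N -> exists2 m : nat, v m%:R = value0 &
  forall x, v x = value0 -> x ^+ n - 1 \in val_max -> x ^+ m - 1 \in val_max.
Proof.
have [k] := ubnP n; elim: k n => // k IHk n nk n0.
have [n1|n1] := leqP n 1.
  by exists 1%N; [rewrite valuation1 | case: n n0 n1 {nk} => [|[]]].
have pp := pdiv_prime n1; set p := pdiv n in pp.
have nE : n = (n %/ p * p)%N by rewrite divnK ?pdiv_dvd.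
have n'n : (n %/ p < n)%N by rewrite ltn_Pdiv ?prime_gt1.
have n'0 : (0 < n %/ p)%N by rewrite divn_gt0 ?prime_gt0 ?pdiv_leq.
have [m vm mP] := IHk _ (leq_trans n'n nk) n'0.
have [pM|pM] := boolP (p%:R \in val_max).
  exists m => // x vx xn; apply: mP => //.
  apply: (one_unit_prime_power pp) => //.
    exact: valuationX_eq0.
  by rewrite -exprM -nE.
have vp : v p%:R = value0.
  by apply/eqP; rewrite val_maxPn ?rpred_nat ?negbK in pM.
exists (p * m)%N; first by rewrite natrM valuationM vp value_add0.
move=> x vx xn; rewrite exprM; apply: mP; first exact: valuationX_eq0.
by rewrite -exprM mulnC -nE.
Qed.
End Valuation.

(** * Compactness and extension of embeddings *)

(* Tychonoff for a product of finite sets. *)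
Lemma finite_choice_limit (T S : choiceType) (B : T -> seq S)
    (f : seq T -> T -> S) :
    (forall X x, f X x \in B x) ->
  exists g : T -> S, forall Y : seq T,
    exists2 X : seq T, {subset Y <= X} & forall y, y \in Y -> f X y = g y.
Proof.
move=> fB.
(* The limit is taken along an ultrafilter on finite lists refining the filter of lists that
   eventually contain any given [Y]. *)
pose above (Y : seq T) : classical_sets.set (seq T) := fun X => {subset Y <= X}.
pose cofinal := filter.filter_from (@classical_sets.setT (seq T)) above.
have cofinalF : filter.Filter cofinal.
  apply: filter.filter_from_filter; first by exists [::].
  move=> X Y _ _; exists (X ++ Y) => // Z XYZ.
  by split=> x xX; apply: XYZ; rewrite mem_cat xX ?orbT.
have cofinal_proper : filter.ProperFilter cofinal.
  split=> // -[Y _ /(_ Y)]; exact.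
have [U [Uultra UF]] := filter.ultraFilterLemma cofinal_proper.
have Uabove Y : U (above Y) by apply: UF; exists Y.
have gP x : exists s, U (fun X => f X x = s).
  have : U (fun X => f X x \in B x).
    by apply: filter.filterS (Uabove [::]) => X _; apply: fB.
  (* An ultrafilter containing a finite union contains one of its pieces; the induction tries the
     candidate values one by one. *)
  elim: (B x) => [|s r IHr] Ux.
    by have [] := filter.filter_ex Ux.
  have [|Us] := filter.in_ultra_setVsetC (fun X => f X x = s) Uultra.
    by exists s.
  apply: IHr; apply: filter.filterS (filter.filterI Ux Us) => X [].
  by rewrite inE => /predU1P[].
have [g gU] := boolp.choice gP.
exists g => Y.
suff : U (fun X => forall y, y \in Y -> f X y = g y).
  move=> UY.
  have [X [YX fg]] := filter.filter_ex (filter.filterI (Uabove Y) UY).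
  by exists X.
elim: Y => [|y Y IHY]; first by apply: filter.filterS (Uabove [::]).
apply: filter.filterS (filter.filterI (gU y) IHY) => X [fy fY] z.
by rewrite inE => /predU1P[->|/fY].
Qed.

(** * Endomorphisms of an algebraic extension: finite conjugates and orbits *)

Section Morphisms.

Lemma rmorphism_ext (A B : nzRingType) (g : A -> B) :
    zmod_morphism g -> monoid_morphism g ->
  exists h : {rmorphism A -> B}, h =1 g.
Proof.
move=> gB gM.
pose ga := GRing.isZmodMorphism.Build A B g gB.
pose gm := GRing.isMonoidMorphism.Build A B g gM.
pose h : {rmorphism A -> B} := HB.pack g ga gm.
by exists h.
Qed.

Lemma iter_rmorphism (A : nzRingType) (s : {rmorphism A -> A}) n :
  exists h : {rmorphism A -> A}, h =1 iter n s.
Proof.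
elim: n => [|n [h hE]]; first by exists idfun.
by exists (s \o h) => x /=; rewrite hE.
Qed.

Lemma root_list (A : fieldType) (p : {poly A}) : p != 0 ->
  exists rs : seq A, forall x, root p x -> x \in rs.
Proof.
have [n] := ubnP (size p); elim: n p => // n IHn p pn p0.
have [[x px]|nox] := boolp.EM (exists x, root p x); last first.
  by exists [::] => x px; case: nox; exists x.
have /factor_theorem[q pq] := px.
have q0 : q != 0 by apply: contraNneq p0 => q0; rewrite pq q0 mul0r.
have [|rs rsP] := IHn q _ q0.
  by move: pn; rewrite pq size_Mmonic ?monicXsubC // size_XsubC addn2.
exists (x :: rs) => y; rewrite pq rootM root_XsubC inE orbC.
by case: eqP => //= _ /rsP.
Qed.

Variables (F E : fieldType) (f : {rmorphism F -> E}).
Hypothesis falg : algebraic_extension f.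

Lemma finite_conjugates x : exists rs : seq E, forall s : {rmorphism E -> E},
  (forall y, s (f y) = f y) -> s x \in rs.
Proof.
have [p p0 px] := falg x.
have [|rs rsP] := @root_list _ (map_poly f p); first by rewrite map_poly_eq0.
exists rs => s sf; apply: rsP.
have -> : map_poly f p = map_poly s (map_poly f p).
  by rewrite -map_poly_comp; apply: eq_map_poly => y; rewrite /= sf.
by rewrite fmorph_root.
Qed.

(** All iterates of [x] lie in a finite list of conjugates, so two of them coincide; injectivity
    cancels the common iterations. *)
Lemma finite_orbit (s : {rmorphism E -> E}) : (forall y, s (f y) = f y) ->
  forall x, exists2 n, (0 < n)%N & iter n s x = x.
Proof.
move=> sf x; have [rs rsP] := finite_conjugates x.
have iters n y : iter n s (f y) = f y by elim: n => //= n ->.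
have sub : {subset traject s x (size rs).+1 <= rs}.
  move=> _ /trajectP[n _ ->]; have [h hE] := iter_rmorphism s n.
  by rewrite -hE rsP // => y; rewrite hE.
have : ~~ uniq (traject s x (size rs).+1).
  by apply/negP => /uniq_leq_size/(_ sub); rewrite size_traject ltnn.
rewrite looping_uniq negbK => /trajectP[m mn eqm].
exists (size rs - m)%N; first by rewrite subn_gt0.
have [h hE] := iter_rmorphism s m; apply: (fmorph_inj h); rewrite !hE.
by rewrite -iterD subnKC // ltnW.
Qed.

Lemma finite_orbits (s : {rmorphism E -> E}) : (forall y, s (f y) = f y) ->
  forall X : seq E, exists2 n, (0 < n)%N & forall x, x \in X -> iter n s x = x.
Proof.
move=> sf; elim=> [|x X [n n0 IHn]]; first by exists 1%N.
have [m m0 xm] := finite_orbit sf x.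
have iter_mul a b y : iter a s y = y -> iter (b * a) s y = y.
  by move=> ya; elim: b => // b IHb; rewrite mulSn iterD IHb.
exists (m * n)%N => [|y]; first by rewrite muln_gt0 m0.
rewrite inE => /predU1P[->|/IHn yn]; last exact: iter_mul.
by rewrite mulnC iter_mul.
Qed.

(** Surjectivity comes from finite orbits: if the orbit of [y] closes after [n.+1] steps, then
    [iter n s y] is a preimage. Hence the endomorphisms obtained by compactness are automatically
    automorphisms. *)
Lemma fixing_in_Gal (s : {rmorphism E -> E}) :
  (forall y, s (f y) = f y) -> in_Gal f s.
Proof.
move=> sf; split=> //.
have surj y : exists x, s x == y.
  by have [[|n] // _ yn] := finite_orbit sf y; exists (iter n s y); apply/eqP.
exists (fun y => xchoose (surj y)) => y; last exact/eqP/(xchooseP (surj y)).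
by apply: (fmorph_inj s); apply/eqP/(xchooseP (surj (s y))).
Qed.

Lemma in_Gal_inv (s : {rmorphism E -> E}) : in_Gal f s ->
  exists t : {rmorphism E -> E}, [/\ in_Gal f t, cancel s t & cancel t s].
Proof.
move=> [[t st ts] sf].
have [||h hE] := @rmorphism_ext _ _ t.
- by move=> x y; apply: (can_inj st); rewrite rmorphB !ts.
- split=> [|x y]; apply: (can_inj st);
    by rewrite ?rmorph1 ?rmorphM !ts ?rmorph1.
exists h; split=> [|x|x]; rewrite ?hE //.
by apply: fixing_in_Gal => y; rewrite hE -[in LHS]sf st.
Qed.
End Morphisms.

(** * Extending embeddings into a separable closure, and Galois descent *)

Lemma min_poly_exists (F E : fieldType) (f : {rmorphism F -> E}) a :
    algebraicOver f a ->
  exists p : {poly F}, [/\ p != 0, root (map_poly f p) a &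
    forall q, root (map_poly f q) a -> p %| q].
Proof.
case=> p p0 pa; have [n] := ubnP (size p).
elim: n p p0 pa => // n IHn p p0 pa pn.
have [pmin|] := boolp.EM (forall q, root (map_poly f q) a -> p %| q).
  by exists p.
move=> /boolp.existsNP[q /boolp.not_implyP[qa /negP pq]].
apply: (IHn (q %% p)) => //; last by rewrite (leq_trans (ltn_modpN0 q p0)).
apply/rootP; move/rootP: qa; rewrite {1}(divp_eq q p) rmorphD rmorphM /=.
by rewrite hornerD hornerM (rootP pa) mulr0 add0r.
Qed.

(** [F'] is the simple extension of [F] by [a]; [g1] is its inclusion and [g2] evaluates polynomials
    at [b] instead of [a]. *)
Lemma extend_hom_root (F E : fieldType) (f1 f2 : {rmorphism F -> E})
    (p : {poly F}) (a b : E) :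
    p != 0 -> root (map_poly f1 p) a ->
    (forall q, root (map_poly f1 q) a -> p %| q) -> root (map_poly f2 p) b ->
  exists (F' : fieldType) (e : {rmorphism F -> F'})
    (g1 g2 : {rmorphism F' -> E}),
    [/\ g1 \o e =1 f1, g2 \o e =1 f2 & exists2 c, g1 c = a & g2 c = b].
Proof.
move=> p0 pa pmin pb.
pose F' := subFExtend f1 a p.
pose ev : {rmorphism {poly F} -> F'} := @subfx_eval _ _ f1 a p.
have evE q : subfx_inj (ev q) = (map_poly f1 q).[a] by apply: subfx_inj_eval.
have qP (x : F') : exists q : {poly F}, x = ev q by apply: subfxE.
have [q qE] := boolp.choice qP.
have evb q1 q2 : ev q1 = ev q2 -> (map_poly f2 q1).[b] = (map_poly f2 q2).[b].
  move=> evq; have /pmin/dvdpP[r rE] : root (map_poly f1 (q1 - q2)) a.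
    by rewrite /root rmorphB hornerD hornerN -!evE evq subrr.
  apply/eqP; rewrite -subr_eq0 -hornerN -hornerD -rmorphB rE rmorphM hornerM.
  by rewrite (rootP pb) mulr0.
(* [q x] is a chosen representative of [x]. By [evb] the value at [b] does not depend on it, as [p]
   divides the difference of two representatives. *)
have [||g2 g2E] := @rmorphism_ext F' E (fun x => (map_poly f2 (q x)).[b]).
- move=> x y; rewrite -hornerN -hornerD -rmorphB; apply: evb.
  by rewrite rmorphB -!qE.
- split=> [|x y].
    rewrite -[RHS](hornerC 1 b) -[1%:P](rmorph1 (map_poly f2)).
    by apply: evb; rewrite -qE rmorph1.
  by rewrite -hornerM -rmorphM; apply: evb; rewrite rmorphM -!qE.
have g2ev r : g2 (ev r) = (map_poly f2 r).[b].
  by rewrite g2E; apply: evb; rewrite -qE.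
exists F', (@inj_subfx _ _ f1 a p), (@subfx_inj _ _ f1 a p), g2; split=> [x|x|].
- by rewrite /= evE map_polyC hornerC.
- by rewrite /= g2ev map_polyC hornerC.
- exists (ev 'X); last by rewrite g2ev map_polyX hornerX.
  by rewrite [LHS]evE map_polyX hornerX.
Qed.

Section Extend.
Variables (K E : fieldType) (f0 : {rmorphism K -> E}).
Hypothesis closE : separable_closure f0.

(** The minimal polynomial over the intermediate field divides the separable one coming from [K],
    and divisors of separable polynomials are separable. *)
Lemma separable_min_poly (F : fieldType) (h : {rmorphism K -> F})
    (f1 : {rmorphism F -> E}) (a : E) : f1 \o h =1 f0 ->
  exists p : {poly F}, [/\ p != 0, root (map_poly f1 p) a,
    forall q, root (map_poly f1 q) a -> p %| q & separable_poly p].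
Proof.
move=> f1h; have [q [qirr qa qsep]] := closE.1 a.
have q'a : root (map_poly f1 (map_poly h q)) a.
  by rewrite -map_poly_comp (eq_map_poly f1h).
have [|p [p0 pa pmin]] := @min_poly_exists _ _ f1 a.
  exists (map_poly h q) => //; rewrite map_poly_eq0.
  by have := qirr.1; apply: contraTneq => ->; rewrite size_poly0.
exists p; split=> //; apply: dvdp_separable (pmin _ q'a) _.
by rewrite separable_map.
Qed.

(** The elements of [X] are adjoined one at a time: the minimal polynomial of the next one,
    transported along [g2], is still separable and so has a root in [E]. Pairs of embeddings of an
    abstract [F'] stand for partial maps on [E]. *)
Lemma finite_extend_hom (F : fieldType) (h : {rmorphism K -> F})
    (f1 f2 : {rmorphism F -> E}) : f1 \o h =1 f0 -> f2 \o h =1 f0 ->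
  forall X : seq E,
  exists (F' : fieldType) (e : {rmorphism F -> F'})
    (g1 g2 : {rmorphism F' -> E}),
    [/\ g1 \o e =1 f1, g2 \o e =1 f2 & forall x, x \in X -> exists c, g1 c = x].
Proof.
move=> f1h f2h; elim=> [|x X [F1 [e1 [g1 [g2 [g1e g2e gX]]]]]].
  by exists F, idfun, f1, f2.
have [|p [p0 px pmin psep]] := @separable_min_poly F1 (e1 \o h) g1 x.
  by move=> y /=; rewrite -f1h /= -g1e.
have [||b pb] := closE.2 (map_poly g2 p).
- by rewrite separable_map.
- rewrite size_map_poly -(size_map_poly g1).
  by rewrite (root_size_gt1 _ px) ?map_poly_eq0.
have [F' [e [k1 [k2 [k1e k2e [c cx cb]]]]]] := extend_hom_root p0 px pmin pb.
exists F', (e \o e1), k1, k2; split=> [y|y|y] /=.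
- by rewrite -g1e -[RHS]k1e.
- by rewrite -g2e -[RHS]k2e.
rewrite inE => /predU1P[->|/gX[z <-]]; first by exists c.
by exists (e z); rewrite -k1e.
Qed.

(** By compactness: extensions defined on finitely many elements have a limit, since each [x] can
    only go to one of the finitely many roots of its polynomial over [K]. *)
Lemma extend_hom (F : fieldType) (h : {rmorphism K -> F})
    (f1 f2 : {rmorphism F -> E}) : f1 \o h =1 f0 -> f2 \o h =1 f0 ->
  exists s : {rmorphism E -> E}, s \o f1 =1 f2.
Proof.
move=> f1h f2h.
have rootsP x : exists rs : seq E, forall (F' : fieldType)
    (e : {rmorphism K -> F'}) (g1 g2 : {rmorphism F' -> E}),
    g1 \o e =1 f0 -> g2 \o e =1 f0 -> forall c, g1 c = x -> g2 c \in rs.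
  have [q [qirr qx _]] := closE.1 x.
  have [|rs rsP] := @root_list _ (map_poly f0 q).
    rewrite map_poly_eq0; have := qirr.1.
    by apply: contraTneq => ->; rewrite size_poly0.
  exists rs => F' e g1 g2 g1e g2e c cx; apply: rsP.
  rewrite -(eq_map_poly g1e) map_poly_comp -cx fmorph_root in qx.
  by rewrite -(eq_map_poly g2e) map_poly_comp fmorph_root.
have [B BP] := boolp.choice rootsP.
have phiP (X : seq E) : exists phi : E -> E, [/\ forall x, phi x \in x :: B x,
    forall z, phi (f1 z) = f2 z, phi 1 = 1 & forall x y, x \in X -> y \in X ->
      phi (x - y) = phi x - phi y /\ phi (x * y) = phi x * phi y].
  have [F' [e [g1 [g2 [g1e g2e gX]]]]] := finite_extend_hom f1h f2h X.
  (* Outside the image of [g1] the value is the default [x], whence the candidate list [x :: B x];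
     on the image it is forced, [g1] being injective. *)
  have yP x : exists y, y \in x :: B x /\ forall c, g1 c = x -> y = g2 c.
    have [[c cx]|nox] := boolp.EM (exists c, g1 c = x).
      exists (g2 c); split=> [|c' c'x]; last first.
        by congr (g2 _); apply: (fmorph_inj g1); rewrite cx.
      rewrite inE (BP _ _ (e \o h) g1) ?orbT // => y /=.
        by rewrite -f1h -[RHS]g1e.
      by rewrite -f2h -[RHS]g2e.
    by exists x; rewrite mem_head; split=> // c cx; case: nox; exists c.
  have [phi phiP] := boolp.choice yP.
  have phig c : phi (g1 c) = g2 c by apply: (phiP _).2.
  exists phi; split=> [x|z||x y /gX[c <-] /gX[d <-]].
  - exact: (phiP x).1.
  - by rewrite -g1e phig -g2e.
  - by have := phig 1; rewrite !rmorph1.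
  - by rewrite -rmorphB -rmorphM !phig rmorphB rmorphM.
have [phi phi_all] := boolp.choice phiP.
have [|g gP] := @finite_choice_limit E E (fun x => x :: B x) phi.
  by move=> X x; have [] := phi_all X.
have [||s sE] := @rmorphism_ext _ _ g.
- move=> x y; have [X XY fg] := gP [:: x; y; x - y].
  have [_ _ _ /(_ x y)[]] := phi_all X; rewrite ?XY ?inE ?eqxx ?orbT //.
  by move=> + _; rewrite !fg ?inE ?eqxx ?orbT.
- split=> [|x y].
    have [X _ fg] := gP [:: 1].
    by have [_ _ + _] := phi_all X; rewrite fg ?inE.
  have [X XY fg] := gP [:: x; y; x * y].
  have [_ _ _ /(_ x y)[]] := phi_all X; rewrite ?XY ?inE ?eqxx ?orbT //.
  by move=> _; rewrite !fg ?inE ?eqxx ?orbT.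
exists s => z; rewrite /= sE; have [X _ fg] := gP [:: f1 z].
by have [_ + _ _] := phi_all X => <-; rewrite fg ?inE.
Qed.

(** If the minimal polynomial of [c] over [L] were not linear, separability would give a second root
    [b], and the embedding sending [c] to [b] would extend to a map of [E] over [L] that moves
    [c]. *)
Lemma galois_descent (L : fieldType) (i : {rmorphism K -> L})
    (j : {rmorphism L -> E}) : j \o i =1 f0 ->
  forall c, (forall s : {rmorphism E -> E}, s \o j =1 j -> s c = c) ->
  exists l, j l = c.
Proof.
move=> ji c cfix; have [p [p0 pc pmin psep]] := separable_min_poly c ji.
have /factor_theorem[q pq] := pc.
have q0 : q != 0.
  by apply: contraNneq p0 => q0; rewrite -(map_poly_eq0 j) pq q0 mul0r.
have psep' : separable_poly (map_poly j p) by rewrite separable_map.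
have [q1|q1] := leqP (size q) 1.
  have szp : size p = 2.
    rewrite -(size_map_poly j) pq size_Mmonic ?monicXsubC //.
    rewrite size_XsubC addn2 /=.
    by move: q0 q1; rewrite -size_poly_gt0; case: (size q) => [|[]].
  have p1 : p`_1 != 0 by move: p0; rewrite -lead_coef_eq0 lead_coefE szp.
  exists (- p`_0 / p`_1).
  move/rootP: pc; rewrite (horner_coef_wide (n := 2)) ?size_map_poly ?szp //.
  rewrite !big_ord_recl big_ord0 !coef_map /= expr0 mulr1 expr1 addr0 => pc.
  rewrite fmorph_div rmorphN; apply: (mulIf (x := j p`_1)).
    by rewrite fmorph_eq0.
  rewrite divfK ?fmorph_eq0 //; apply/eqP; rewrite eq_sym -addr_eq0 mulrC addrC.
  exact/eqP.
have [|b qb] := closE.2 q _ q1.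
  by apply: dvdp_separable psep'; rewrite pq dvdp_mulr.
have bc : b != c.
  by apply: contraTneq psep' => bc; rewrite pq separable_root -bc qb andbF.
have pb : root (map_poly j p) b by rewrite pq rootM qb.
have [F' [e [g1 [g2 [g1e g2e [d dc db]]]]]] := extend_hom_root p0 pc pmin pb.
have [||s sE] := @extend_hom F' (e \o i) g1 g2.
- by move=> y /=; rewrite -[RHS]ji -[RHS]g1e.
- by move=> y /=; rewrite -[RHS]ji -[RHS]g2e.
case/eqP: bc; rewrite -db -[g2 d]sE /= dc cfix // => y /=.
by rewrite -[in LHS]g1e -[RHS]g2e -[RHS]sE.
Qed.
End Extend.

(** * Lifting ramification automorphisms *)

Section GaussLemma.
Variables (F : fieldType) (G : orderedGroupType) (v : valuation F G).
Implicit Types p q : {poly F}.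

Lemma polyOver_maxM p q : p \is a polyOver (val_max v) ->
  q \is a polyOver (val_ring v) -> p * q \is a polyOver (val_max v).
Proof.
move=> /polyOverP pM /polyOverP qO; apply/polyOverP => a.
by rewrite coefM rpred_sum // => b _; rewrite val_maxMr.
Qed.

(** Take the lowest coefficients, of indices [a] and [b], outside the maximal ideal. The coefficient
    of index [a + b] of the product is their product modulo the maximal ideal, hence outside it. *)
Lemma polyOver_max_prime p q : p \is a polyOver (val_ring v) ->
  q \is a polyOver (val_ring v) -> p * q \is a polyOver (val_max v) ->
  (p \is a polyOver (val_max v)) || (q \is a polyOver (val_max v)).
Proof.
move=> /polyOverP pO /polyOverP qO /polyOverP pqM.
have firstP r : r \isn't a polyOver (val_max v) ->
    exists2 a, r`_a \notin val_max v &
      forall b, (b < a)%N -> r`_b \in val_max v.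
  move=> rM; have ex : exists a, r`_a \notin val_max v.
    apply: boolp.contrapT => /boolp.forallNP r_all; case/polyOverP: rM => a.
    exact/negPn/negP/r_all.
  case: (ex_minnP ex) => a aM amin; exists a => // b; apply: contraTT => /amin.
  by rewrite -leqNgt.
rewrite -[X in is_true X]negbK negb_or.
apply/negP => /andP[/firstP[a aM a_lt] /firstP[b bM b_lt]].
have := pqM (a + b)%N; rewrite coefM.
have ab : (a < (a + b).+1)%N by rewrite ltnS leq_addr.
rewrite (bigD1 (Ordinal ab)) //= addKn rpredDr.
  by move=> /(val_max_prime (pO _) (qO _)); rewrite (negPf aM) (negPf bM).
apply: rpred_sum => -[c c_le] /= ca; have {ca} : c != a by [].
rewrite neq_ltn => /orP[/a_lt cM|ac]; first exact: val_maxMr.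
by apply: val_maxM => //; apply: b_lt; rewrite ltn_subLR // ltn_add2r.
Qed.

Lemma polyOver_max_prod (I : eqType) (r : seq I) (P : I -> {poly F}) :
    (forall k, k \in r -> P k \is a polyOver (val_ring v)) ->
    \prod_(k <- r) P k \is a polyOver (val_max v) ->
  exists2 k, k \in r & P k \is a polyOver (val_max v).
Proof.
elim: r => [|k r IHr] PO.
  rewrite big_nil => /polyOverP/(_ 0%N); rewrite coef1 eqxx.
  by rewrite (negPf (unit_notin_max (valuation1 v))).
have rO l : l \in r -> P l \is a polyOver (val_ring v).
  by move=> lr; rewrite PO // inE lr orbT.
rewrite big_cons => /polyOver_max_prime/orP[||Pk|/IHr[//|l lr Pl]].
- by rewrite PO ?mem_head.
- by rewrite big_seq rpred_prod.
- by exists k; rewrite ?mem_head.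
- by exists l; rewrite // inE lr orbT.
Qed.

End GaussLemma.

Section OneUnits.
Variables (F : fieldType) (G : orderedGroupType) (v : valuation F G).

Lemma one_unitM (x y : F) : x - 1 \in val_max v -> y - 1 \in val_max v ->
  x * y - 1 \in val_max v.
Proof.
move=> xM yM; have -> : x * y - 1 = (x - 1) * y + (y - 1).
  by rewrite mulrBl mul1r addrA subrK.
by rewrite rpredD ?val_maxMr // unit_val_ring // one_unit_valuation.
Qed.

(* Averaging over the powers of [s] produces a fixed point. *)
Lemma ramified_unit_power_fixed (s : {rmorphism F -> F}) (m : nat) (x : F) :
    (forall d, d != 0 -> s d / d - 1 \in val_max v) ->
    v m%:R = value0 -> iter m s x = x -> s x = x.
Proof.
move=> sM vm smx.
have m0 : m%:R != 0 :> F by rewrite -(valuation_neq_infty v) vm.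
pose t := (\sum_(a < m) iter a s x) / m%:R.
have st : s t = t.
  rewrite /t fmorph_div rmorph_nat rmorph_sum; congr (_ / _).
  case: m smx {vm m0 t} => [|m] smx; first by rewrite !big_ord0.
  by rewrite big_ord_recr big_ord_recl /= -[s _]/(iter m.+1 s x) smx addrC.
have iter_t a : iter a s t = t by elim: a => //= a ->.
suff /eqP : x - t = 0 by rewrite subr_eq0 => /eqP ->.
apply/eqP/negPn/negP => y0; set y := x - t in y0.
have iterM a : iter a s y / y - 1 \in val_max v.
  elim: a => [|a IHa] /=; first by rewrite divff // subrr rpred0.
  have [h hE] := iter_rmorphism s a.
  have z0 : iter a s y != 0 by rewrite -hE fmorph_eq0.
  rewrite (_ : _ / y = s (iter a s y) / iter a s y * (iter a s y / y)).
    exact: one_unitM (sM _ z0) IHa.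
  by rewrite mulrA divfK.
have sum0 : \sum_(a < m) iter a s y = 0.
  rewrite (eq_bigr (fun a : 'I_m => iter a s x - t)) => [|a _].
    by rewrite sumrB sumr_const card_ord -mulr_natr divfK // subrr.
  by have [h hE] := iter_rmorphism s a; rewrite -!hE rmorphB [h t]hE iter_t.
(* The iterates of [y] sum to zero, yet each is [y] times a one-unit, so their sum divided by [y] is
   congruent to the unit [m]. *)
have : v (m%:R + \sum_(a < m) (iter a s y / y - 1)) = value0.
  by apply: valuation_unitD => //; apply: rpred_sum => a _.
rewrite sumrB -mulr_suml sum0 mul0r add0r sumr_const card_ord subrr.
by rewrite valuation0.
Qed.

End OneUnits.

(** * Galois invariance of a henselian valuation *)

Section Invariance.
Variables (F E : fieldType) (f : {rmorphism F -> E}).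
Variables (G : orderedGroupType) (v : valuation E G).
Hypothesis falg : algebraic_extension f.
Hypothesis hens : henselian (vrestrict f v).

Lemma valuation_le_div x y : x != 0 -> (v x <= v y) = (value0 <= v (y / x)).
Proof.
move=> x0; rewrite -[RHS](value_leD2rE _ _ (c := v x)) ?valuation_neq_infty //.
by rewrite value_add0 -valuationM divfK.
Qed.

(** Both [v] and [v \o s] extend the valuation of [F], so they have the same valuation ring and [s]
    preserves the order of values. Finite orbits then give equality of values. *)
Lemma henselian_invariant (s : {rmorphism E -> E}) :
  (forall y, s (f y) = f y) -> forall x, v (s x) = v x.
Proof.
move=> sf x.
have ringE y : (value0 <= v y) = (value0 <= v (s y)).
  apply: (hens (w1 := v) (w2 := vrestrict s v) falg) => z //=.
  by rewrite /= sf.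
have [->|x0] := eqVneq x 0; first by rewrite rmorph0.
have mono y z : y != 0 -> (v (s y) <= v (s z)) = (v y <= v z).
  by move=> y0; rewrite !valuation_le_div ?fmorph_eq0 // -fmorph_div -ringE.
have iter0 n : iter n s x != 0.
  by have [h hE] := iter_rmorphism s n; rewrite -hE fmorph_eq0.
have [[|n] // _ xn] := finite_orbit falg sf x.
(* A strict inequality between [v (s x)] and [v x] would propagate by monotonicity along the orbit
   until it returns to [x]. *)
apply: le_anti; apply/andP; split; rewrite leNgt; apply/negP => xs.
  suff /(_ n) : forall n, v x < v (iter n.+1 s x) by rewrite xn ltxx.
  elim=> [|k IHk] //; apply: lt_trans xs _.
  by rewrite ltNge [iter k.+2 s x]/(s (iter k.+1 s x)) mono -?ltNge.
suff /(_ n) : forall n, v (iter n.+1 s x) < v x by rewrite xn ltxx.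
elim=> [|k IHk] //; apply: lt_trans xs.
by rewrite ltNge [iter k.+2 s x]/(s (iter k.+1 s x)) mono -?ltNge.
Qed.
End Invariance.

Lemma finite_conjugate_lists (F E : fieldType) (f : {rmorphism F -> E})
    (falg : algebraic_extension f) (X : seq E) :
  exists T : seq (seq E), forall s : {rmorphism E -> E},
    (forall y, s (f y) = f y) -> map s X \in T.
Proof.
elim: X => [|x X [T TP]]; first by exists [:: [::]] => s _; rewrite inE.
have [rs rsP] := finite_conjugates falg x.
exists [seq y :: Y | y <- rs, Y <- T] => s sf /=.
by apply/allpairsP; exists (s x, map s X); split; rewrite ?rsP ?TP.
Qed.

(** The orbit comes as a duplicate-free list with exact membership, so that an injective map of it
    into itself permutes it. The predicate [A] will be the fixing of [L]. *)
Lemma finite_conjugate_polys (F E : fieldType) (f : {rmorphism F -> E})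
    (falg : algebraic_extension f) (P : {poly E})
    (A : {rmorphism E -> E} -> Prop) :
    (forall s, A s -> forall y, s (f y) = f y) ->
  exists2 S : seq {poly E}, uniq S &
    forall Q, (Q \in S) <-> exists2 s, A s & Q = map_poly s P.
Proof.
move=> Af; have [T TP] := finite_conjugate_lists falg P.
pose test (Q : {poly E}) := boolp.asbool (exists2 s, A s & Q = map_poly s P).
exists (undup [seq Q <- map Poly T | test Q]); first exact: undup_uniq.
move=> Q; rewrite mem_undup mem_filter; split=> [/andP[/boolp.asboolP]//|QA].
apply/andP; split; first exact/boolp.asboolP.
have [s As ->] := QA; apply/mapP; exists (map s P); first exact/TP/Af.
by rewrite map_polyE.
Qed.

(** * Lifts acting trivially on finitely many residues *)

Section InertialLift.
Variables (K L E : fieldType) (i : {rmorphism K -> L}) (j : {rmorphism L -> E}).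
Variables (G : orderedGroupType) (v : valuation E G).
Hypothesis closE : separable_closure (j \o i).
Hypothesis Ealg : algebraic_extension (j \o i).
Hypothesis v_inv : forall s : {rmorphism E -> E},
  (forall y, s (j (i y)) = j (i y)) -> forall x, v (s x) = v x.

Variable s : {rmorphism L -> L}.
Hypothesis si : s \o i =1 i.
Hypothesis s_inert : forall x,
  j x \in val_ring v -> j (s x) - j x \in val_max v.

(* With [P] the polynomial with coefficients [Z], the product of the [Y - P']
   over the conjugates [P'] of [P] over [L] has coefficients in [L], hence is
   fixed by [s] modulo the maximal ideal.  Evaluating its image under an
   extension [t] of [s] at [P] gives a product of the [P - t P'] that vanishes
   modulo the maximal ideal; by Gauss's lemma one of the factors does. *)
Lemma inertial_lift (Z : seq E) : {subset Z <= val_ring v} ->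
  exists2 t : {rmorphism E -> E}, t \o j =1 j \o s &
    forall z, z \in Z -> t z - z \in val_max v.
Proof.
move=> ZO; pose P := Poly Z.
have [|t tj] := extend_hom closE (frefl (j \o i)) (f2 := j \o s).
  by move=> y /=; rewrite -[RHS](congr1 j (si y)).
have t_inv x : v (t x) = v x.
  by apply: v_inv => y; rewrite [LHS]tj /= -[RHS](congr1 j (si y)).
pose fixL (g : {rmorphism E -> E}) := forall y, g (j y) = j y.
have [|S Suniq SP] := finite_conjugate_polys Ealg P (A := fixL).
  by move=> g gL y; apply: gL.
have PO : P \is a polyOver (val_ring v).
  apply/polyOverP => a; rewrite coef_Poly.
  have [aZ|aZ] := ltnP a (size Z); first by rewrite ZO ?mem_nth.
  by rewrite nth_default ?rpred0.
have ringE (g : {rmorphism E -> E}) (p : {poly E}) :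
    (forall x, v (g x) = v x) ->
    p \is a polyOver (val_ring v) -> map_poly g p \is a polyOver (val_ring v).
  move=> gv /polyOverP pO; apply/polyOverP => a.
  by rewrite coef_map /= unfold_in /val_ring gv; apply: pO.
have SO P' : P' \in S -> P' \is a polyOver (val_ring v).
  move=> /SP[g gL ->]; apply: ringE PO => x; apply: v_inv => y; exact: gL.
have PS : P \in S by apply/SP; exists idfun => //; rewrite map_poly_id.
pose Q : {poly {poly E}} := \prod_(P' <- S) ('X - P'%:P).
have QE (g : {rmorphism E -> E}) : map_poly (map_poly g) Q =
    \prod_(P' <- S) ('X - (map_poly g P')%:P).
  rewrite rmorph_prod; apply: eq_bigr => P' _.
  by rewrite rmorphB /= map_polyX map_polyC.
have QO a : Q`_a \is a polyOver (val_ring v).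
  rewrite /Q big_seq; move: a; apply: (big_ind (fun Q : {poly {poly E}} =>
    forall a, Q`_a \is a polyOver (val_ring v)))
    => [a|Q1 Q2 Q1O Q2O a|P' /SO P'O a].
  - by rewrite coef1 rpred_nat.
  - by rewrite coefM rpred_sum // => b _; rewrite rpredM.
  - rewrite coefB coefX coefC rpredB ?rpred_nat //.
    by case: eqP; rewrite ?rpred0.
(* [g] maps the finite orbit [S] injectively into itself, so it only permutes the factors of [Q]. *)
have Qfix g : fixL g -> map_poly (map_poly g) Q = Q.
  move=> gL; rewrite QE -(big_map (map_poly g) xpredT (fun P' => 'X - P'%:P)).
  apply: perm_big; have gS_uniq : uniq (map (map_poly g) S).
    by rewrite map_inj_uniq //; apply: map_poly_inj.
  have gS_sub : {subset map (map_poly g) S <= S}.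
    move=> _ /mapP[P' /SP[h hL ->] ->]; apply/SP; exists (g \o h).
      by move=> y /=; rewrite hL.
    by rewrite map_poly_comp.
  have [] := uniq_min_size gS_uniq gS_sub; first by rewrite size_map.
  by move=> _ gSE; apply: uniq_perm.
have QM a : (map_poly (map_poly t) Q - Q)`_a \is a polyOver (val_max v).
  apply/polyOverP => b; rewrite !coefB !coef_map /=.
  have [l lE] : exists l, j l = Q`_a`_b.
    apply: (galois_descent closE (frefl _)) => g gL.
    by rewrite -[in RHS](Qfix g gL) !coef_map.
  rewrite -lE [t _]tj; apply: s_inert; rewrite lE.
  exact: (polyOverP (QO a)).
have : (map_poly (map_poly t) Q - Q).[P] \is a polyOver (val_max v).
  rewrite horner_coef; apply: rpred_sum => a _; apply: polyOver_maxM.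
    exact: QM.
  exact: rpredX.
have QP0 : Q.[P] = 0.
  by rewrite horner_prod (big_rem _ PS) /= hornerXsubC subrr mul0r.
rewrite hornerD hornerN QP0 subr0 QE horner_prod.
case/polyOver_max_prod => [P' P'S|P' /SP[g gL ->]].
  by rewrite hornerXsubC rpredB // ringE ?SO.
rewrite hornerXsubC -map_poly_comp => /polyOverP PtP.
(* The factor found by Gauss's lemma says that [t \o g] fixes the coefficients of [P] modulo the
   maximal ideal; as [g] fixes [L], this map still extends [s]. *)
exists (t \o g) => [y|z zZ]; first by rewrite -[RHS]tj /= gL.
have := PtP (index z Z); rewrite coefB coef_map coef_Poly nth_index //.
by rewrite -[t (g z) - z]opprB rpredN.
Qed.

End InertialLift.

(** * Lifting a ramification automorphism to the separable closure *)

Section RamificationLift.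
Variables (K L E : fieldType) (i : {rmorphism K -> L}) (j : {rmorphism L -> E}).
Variables (G : orderedGroupType) (v : valuation E G).
Hypothesis closE : separable_closure (j \o i).
Hypothesis v_inv : forall s : {rmorphism E -> E},
  (forall y, s (j (i y)) = j (i y)) -> forall x, v (s x) = v x.

Lemma separable_closure_algebraic : algebraic_extension (j \o i).
Proof.
move=> x; have [p [pirr px _]] := closE.1 x; exists p => //.
by have := pirr.1; apply: contraTneq => ->; rewrite size_poly0.
Qed.

Let Ealg := separable_closure_algebraic.

Variable s : {rmorphism L -> L}.
Hypothesis s_ram : in_ramification_group i (vrestrict j v) s.

Let si : s \o i =1 i. Proof. exact: s_ram.1.2. Qed.
Let sM d : d != 0 -> s d / d - 1 \in val_max (vrestrict j v).
Proof. exact: s_ram.2. Qed.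

Let s_inert x : j x \in val_ring v -> j (s x) - j x \in val_max v.
Proof.
move=> xO; have [->|x0] := eqVneq x 0; first by rewrite !rmorph0 subrr rpred0.
have -> : j (s x) - j x = j (s x / x - 1) * j x.
  by rewrite -rmorphM mulrBl mul1r divfK // rmorphB.
by apply: val_maxMr => //; apply: sM.
Qed.

(* A power [t ^ m] of an inertial lift [t], with [m] prime to the residue
   characteristic, acts on [X] like a ramification element, because the
   characters [x |-> t x / x] have finite order on [X]. *)
Lemma local_ramification_lift (x0 : L) : s x0 != x0 ->
  forall X : seq E, exists t : {rmorphism E -> E},
    [/\ t \o (j \o i) =1 j \o i, t (j x0) != j x0 &
      forall d, d \in X -> d != 0 -> t d / d - 1 \in val_max v].
Proof.
move=> sx0 X; have [T TP] := finite_conjugate_lists Ealg X.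
(* [C] contains all conjugates over [K] of elements of [X], and [Z] their integral quotients; so for
   [d] in [X] the element [t d / d] and its images under iterates of [t] lie in [Z]. *)
pose C := flatten T.
have CP (t : {rmorphism E -> E}) x : (forall y, t (j (i y)) = j (i y)) ->
    x \in X -> t x \in C.
  by move=> /TP tT xX; apply/flattenP; exists (map t X) => //; apply: map_f.
pose Z := [seq z <- [seq y / x | y <- C, x <- C] | z \in val_ring v].
have ZP (x y : E) : x \in C -> y \in C -> v (x / y) = value0 -> x / y \in Z.
  move=> xC yC vxy; rewrite mem_filter unit_val_ring //=.
  by apply/allpairsP; exists (x, y).
have [|t tj tZ] := inertial_lift closE Ealg v_inv si s_inert (Z := Z).
  by move=> z; rewrite mem_filter => /andP[].
have tK y : t (j (i y)) = j (i y) by rewrite [LHS]tj /= -[RHS](congr1 j (si y)).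
have [n n0 tn] := finite_orbits Ealg tK X.
have [m vm mP] := unit_root_prime_part v n0.
have [f fE] := iter_rmorphism t m.
have iterK k y : iter k t (j (i y)) = j (i y) by elim: k => //= k ->.
have fj y : f (j y) = j (iter m s y).
  by rewrite fE; elim: (m) => //= k ->; rewrite [LHS]tj.
exists f; split=> [y||d dX d0]; first by rewrite /= fE iterK.
  (* If [iter m s] fixed [x0], so would [s], because [m] is a unit and [s] a ramification
     element. *)
  rewrite fj fmorph_eq; apply: contra sx0 => /eqP smx; apply/eqP.
  apply: (@ramified_unit_power_fixed L G (vrestrict j v) s m) => //=.
  by rewrite rmorph_nat.
pose u := t d / d.
have iterC k : iter k t d \in C.
  have [h hE] := iter_rmorphism t k; rewrite -hE; apply: CP => // y.
  by rewrite hE iterK.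
have iter_inv k x : v (iter k t x) = v x.
  have [h hE] := iter_rmorphism t k; rewrite -hE; apply: v_inv => y.
  by rewrite hE iterK.
have div_unit (x y : E) : x != 0 -> v x = v y -> v (y / x) = value0.
  move=> xn0 vxy; have := valuationM v (y / x) x; rewrite divfK // -vxy.
  have : v x != infty by rewrite valuation_neq_infty.
  case: (v x) (v (y / x)) => [a|] // [b|] //= _ [ab].
  by have -> : b = 0 by apply: (@addIr _ a); rewrite add0r.
have iter_u k : iter k t u \in Z /\ v (iter k t u) = value0.
  have [h hE] := iter_rmorphism t k.
  have tku : iter k t u = iter k.+1 t d / iter k t d.
    by rewrite iterSr -!hE fmorph_div.
  have vtku : v (iter k t u) = value0.
    by rewrite iter_inv div_unit // v_inv.
  by split=> //; rewrite tku ZP // -tku.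
have vu : v u = value0 by have [] := iter_u 0%N.
(* As [t] is trivial on the residues of [Z], it fixes [u] modulo the maximal ideal; hence
   [iter k t d / d] telescopes to [u ^+ k]. *)
have iter_u1 k : iter k t u - u \in val_max v.
  elim: k => [|k IHk]; first by rewrite subrr rpred0.
  rewrite -(subrK (iter k t u) (iter k.+1 t u)) -addrA rpredD //.
  by apply: tZ; have [] := iter_u k.
have iter_d k : iter k t d / d - u ^+ k \in val_max v.
  elim: k => [|k IHk]; first by rewrite divff // subrr rpred0.
  have [h hE] := iter_rmorphism t k.
  have td0 : iter k t d != 0 by rewrite -hE fmorph_eq0.
  have -> : iter k.+1 t d / d - u ^+ k.+1 =
      iter k t u * (iter k t d / d - u ^+ k) + (iter k t u - u) * u ^+ k.
    rewrite mulrBr mulrBl -exprS addrA subrK; congr (_ - _).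
    by rewrite iterSr -!hE fmorph_div !hE mulrA divfK.
  apply: rpredD.
    by rewrite val_maxM ?unit_val_ring //; have [] := iter_u k.
  by rewrite val_maxMr // unit_val_ring // valuationX_eq0.
(* The orbit of [d] closes after [n] steps, so [u ^+ n] is a one-unit; [mP] passes from [n] to its
   prime-to-characteristic part [m]. *)
have um : u ^+ m - 1 \in val_max v.
  apply: mP => //; rewrite -opprB rpredN.
  by have := iter_d n; rewrite tn // divff.
by rewrite fE -(subrK (u ^+ m) (_ / d)) -addrA rpredD.
Qed.

(** By compactness: the local lifts send each element to one of its finitely many conjugates, and
    every condition on the limit involves finitely many elements only. *)
Lemma ramification_lift (x0 : L) : s x0 != x0 ->
  exists2 t : {rmorphism E -> E}, in_ramification_group (j \o i) v t &
    t (j x0) != j x0.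
Proof.
move=> /local_ramification_lift /boolp.choice[t tP].
have [B BP] := boolp.choice (finite_conjugates Ealg).
have [X x|g gP] := @finite_choice_limit E E B (fun X => t X).
  by apply: BP => y; have [+ _ _] := tP X; apply.
have gE (Y : seq E) :
    exists2 X : seq E, {subset Y <= X} & forall y, y \in Y -> g y = t X y.
  by have [X YX tg] := gP Y; exists X => // y /tg.
have [||h hE] := @rmorphism_ext _ _ g.
- move=> x y; have [X _ gX] := gE [:: x; y; x - y].
  by rewrite !gX ?inE ?eqxx ?orbT // rmorphB.
- split=> [|x y].
    by have [X _ gX] := gE [:: 1]; rewrite gX ?inE // rmorph1.
  have [X _ gX] := gE [:: x; y; x * y].
  by rewrite !gX ?inE ?eqxx ?orbT // rmorphM.
exists h; last first.
  by have [X _ gX] := gE [:: j x0]; rewrite hE gX ?inE //; have [] := tP X.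
split.
  apply: fixing_in_Gal => // y; have [X _ gX] := gE [:: (j \o i) y].
  by rewrite hE gX ?inE //; have [+ _ _] := tP X; apply.
move=> d d0; have [X YX gX] := gE [:: d].
by rewrite hE gX ?inE //; have [_ _] := tP X; apply; rewrite ?YX ?inE.
Qed.

End RamificationLift.

(** An [s] moving [x] would lift to a ramification automorphism of [E] moving [j x], against
    tameness. *)
Lemma tame_ramification_trivial (K L E : fieldType) (i : {rmorphism K -> L})
    (j : {rmorphism L -> E}) (G : orderedGroupType) (v : valuation E G) :
    separable_closure (j \o i) -> henselian (vrestrict (j \o i) v) ->
    tame i j v ->
  forall s, in_ramification_group i (vrestrict j v) s -> s =1 id.
Proof.
move=> closE hens [_ tameP] s s_ram x; apply/eqP/negPn/negP => sx.
have v_inv := henselian_invariant (separable_closure_algebraic closE) hens.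
have [t t_ram /eqP] := ramification_lift closE v_inv s_ram sx; apply.
exact: tameP.
Qed.

(** * Valuation independence *)

(* Artin's independence of characters, read in the residue field. *)
Lemma residue_characters_independent (L E : fieldType) (G : orderedGroupType)
    (v : valuation E G) (I : eqType) (chi : I -> L -> E) :
    (forall a, chi a 1 = 1) ->
    (forall a x y, chi a (x * y) = chi a x * chi a y) ->
    (forall a x, x != 0 -> v (chi a x) = value0) ->
    (forall a b, a != b ->
      exists2 x, x != 0 & chi a x - chi b x \notin val_max v) ->
  forall (r : seq I) (c : I -> E) (a0 : I), uniq r -> a0 \in r ->
    (forall a, c a \in val_ring v) -> v (c a0) = value0 ->
  exists2 x, x != 0 & v (\sum_(a <- r) chi a x * c a) = value0.
Proof.
move=> chi1 chiM chi_unit chi_sep r.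
have [n] := ubnP (size r); elim: n r => // n IHn r rn c a0 r_uniq ra0 cO ca0.
have chiO a x : x != 0 -> chi a x \in val_ring v.
  by move=> x0; rewrite unit_val_ring ?chi_unit.
have sumO (q : seq I) x : x != 0 -> \sum_(a <- q) chi a x * c a \in val_ring v.
  by move=> x0; apply: rpred_sum => a _; rewrite rpredM ?chiO.
have [/hasP[a1 ra1 a10]|/hasPn r_a0] := boolP (has (predC1 a0) r); last first.
  exists 1; first exact: oner_neq0.
  have -> : r = [:: a0].
    apply: perm_small_eq => //; apply: uniq_perm => // a; rewrite inE.
    by apply/idP/eqP => [/r_a0/negPn/eqP|->].
  by rewrite big_seq1 chi1 mul1r.
have [|y y0 chiy] := chi_sep a0 a1; first by rewrite eq_sym.
(* Artin's elimination: [c' a1] vanishes, while [c' a0] stays a unit because [y] separates the two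
   residue characters. *)
pose c' a := (chi a y - chi a1 y) * c a.
have diffO a : chi a y - chi a1 y \in val_ring v by rewrite rpredB ?chiO.
have [||||x x0 sumx] := IHn (rem a1 r) _ c' a0 (rem_uniq _ r_uniq).
- by rewrite size_rem //; case: (r) ra1 rn.
- by rewrite mem_rem_uniq // inE ra0 andbT eq_sym.
- by move=> a; rewrite rpredM ?diffO.
- apply/eqP; rewrite -[_ == _]negbK -val_maxPn; last by rewrite rpredM ?diffO.
  apply/negP => /(val_max_prime (diffO a0) (cO a0)).
  by rewrite (negPf chiy) (negPf (unit_notin_max ca0)).
have sumE : \sum_(a <- rem a1 r) chi a x * c' a =
    \sum_(a <- r) chi a (y * x) * c a - chi a1 y * \sum_(a <- r) chi a x * c a.
  rewrite mulr_sumr -sumrB [RHS](big_rem _ ra1) /= chiM mulrA subrr add0r.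
  by apply: eq_bigr => a _; rewrite chiM /c' !mulrA -!mulrBl [chi a x * _]mulrC.
have [vx|vx] := eqVneq (v (\sum_(a <- r) chi a x * c a)) value0.
  by exists x.
exists (y * x); first exact: mulf_neq0.
(* Were the sums at [x] and [y * x] both in the maximal ideal, [sumE] would put the shorter sum
   there, against the induction hypothesis. *)
apply/eqP/negPn/negP => vyx; have yx0 : y * x != 0 by apply: mulf_neq0.
have := unit_notin_max sumx; rewrite sumE rpredB //.
  by rewrite val_maxPn ?sumO.
by rewrite val_maxM ?chiO // val_maxPn ?sumO.
Qed.

Lemma ramification_trivial_valuation_independent (K L E : fieldType)
    (i : {rmorphism K -> L}) (e : {rmorphism L -> E})
    (G : orderedGroupType) (v : valuation E G) :
    algebraic_extension i -> henselian (vrestrict (e \o i) v) ->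
    (forall s, in_ramification_group i (vrestrict e v) s -> s =1 id) ->
  valuation_independent i e v.
Proof.
move=> alg hens ram n d_ s n0 sG s_inj.
have v_inv (t : {rmorphism L -> L}) : (forall y, t (i y) = i y) ->
    forall x, v (e (t x)) = v (e x).
  by apply: (henselian_invariant (v := vrestrict e v) alg).
pose chi (a : 'I_n) x := e (s a x / x).
have chi_unit a x : x != 0 -> v (chi a x) = value0.
  move=> x0; rewrite /chi fmorph_div valuationM v_inv; last exact: (sG a).2.
  by rewrite -valuationM divff ?valuation1 // fmorph_eq0.
have chi_sep a b : a != b ->
    exists2 x, x != 0 & chi a x - chi b x \notin val_max v.
  (* If the residue characters agree, then [t \o s a], with [t] inverse to [s b], lies in the
     ramification group; so it is trivial and [s a] equals [s b]. *)
  move=> ab; apply: boolp.contrapT => nox; case/eqP: ab; apply: s_inj.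
  have [t [tG ts st]] := in_Gal_inv alg (sG b).
  have tsa : t \o s a =1 id.
    apply: ram; split=> [|x x0].
      by apply: fixing_in_Gal => // y; rewrite /= (sG a).2 tG.2.
    have sxM : chi a x - chi b x \in val_max v.
      by apply/negPn/negP => xM; apply: nox; exists x.
    have sbx0 : s b x != 0 by rewrite fmorph_eq0.
    have : s a x / s b x - 1 \in val_max (vrestrict e v).
      rewrite [_ \in _](_ : _ = (e (s a x / s b x - 1) \in val_max v)) //.
      rewrite -(unitM_max _ (chi_unit b x x0)) -rmorphM mulrBr mulr1 mulrC.
      by rewrite mulrA divfK // rmorphB.
    rewrite !unfold_in /val_max /= -(v_inv t tG.2 (_ - 1)).
    by rewrite rmorphB fmorph_div rmorph1 ts.
  by move=> x; rewrite -[LHS]st [t _]tsa.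
pose a1 := Ordinal n0.
have [a0 _ a0_min] := arg_minP (fun a => v (d_ a)) (isT : xpredT a1).
(* If the least value is infinite, all coefficients vanish and both sides are [infty] for any
   nonzero element. *)
have [d0|d0] := eqVneq (d_ a0) 0.
  have d_0 a : d_ a = 0.
    apply/eqP/negPn; rewrite -(valuation_neq_infty v) negbK.
    by have := a0_min a isT; rewrite d0 valuation0; case: (v _).
  exists 1; first exact: oner_neq0.
  rewrite big1 => [|a _]; last by rewrite d_0 mulr0.
  rewrite valuation0; apply/esym; rewrite big1_idem // => a _.
  by rewrite d_0 mulr0 valuation0.
(* Dividing by a coefficient of least value makes all coefficients integral and one of them a
   unit. *)
pose c a := d_ a / d_ a0.
have cO a : c a \in val_ring v.
  by rewrite unfold_in /val_ring -valuation_le_div // a0_min.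
have ca0 : v (c a0) = value0 by rewrite /c divff ?valuation1.
have [||x x0 sumx] := residue_characters_independent _ _ chi_unit chi_sep
  (index_enum_uniq _) (mem_index_enum a0) cO ca0.
- by move=> a; rewrite /chi rmorph1 divr1 rmorph1.
- by move=> a x y; rewrite /chi -rmorphM [s a _]rmorphM invfM mulrACA.
have termE a : v (e (s a x) * d_ a) = value_add (v (e x)) (v (d_ a)).
  by rewrite valuationM v_inv //; apply: (sG a).2.
exists x => //.
rewrite (eq_bigr (fun a => e x * d_ a0 * (chi a x * c a))); last first.
  move=> a _; rewrite mulrACA -rmorphM [x * _]mulrC divfK //.
  by rewrite [d_ a0 * _]mulrC divfK.
rewrite -mulr_sumr valuationM sumx value_addC value_add0 valuationM -termE.
(* By invariance all terms are shifted by the same [v (e x)], so [a0] also realises the minimum over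
   the terms. *)
apply: le_anti; apply/andP; split; last exact: bigmin_le.
apply: le_bigmin => [|a _]; first by case: (v _).
rewrite !termE ![value_add (v (e x)) _]value_addC; apply: value_leD2r.
exact: a0_min.
Qed.

(** [t] sends [j y] to a root of the minimal polynomial of [y] over [K]; by normality all these
    roots come from [L]. *)
Lemma normal_restriction (K L E : fieldType) (i : {rmorphism K -> L})
    (j : {rmorphism L -> E}) (t : {rmorphism E -> E}) :
    galois_extension i -> t \o (j \o i) =1 j \o i ->
  exists2 s : {rmorphism L -> L}, in_Gal i s & t \o j =1 j \o s.
Proof.
move=> [[alg normal] sep] tji.
have sP y : exists z, j z = t (j y).
  have [p [pirr py _]] := sep y.
  have [|rs prs] := normal p pirr; first by exists y.
  have : root (map_poly (j \o i) p) (t (j y)).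
    by rewrite -(eq_map_poly tji) !(map_poly_comp, fmorph_root).
  rewrite map_poly_comp.
  rewrite (eqp_root (q := map_poly j (\prod_(z <- rs) ('X - z%:P)))).
    rewrite rmorph_prod.
    rewrite (eq_bigr (fun z => 'X - (j z)%:P)) => [|z _]; last first.
      exact: map_polyXsubC.
    rewrite -(big_map j xpredT (fun z => 'X - z%:P)) root_prod_XsubC.
    by move=> /mapP[z _ ->]; exists z.
  by rewrite eqp_map.
have [s sE] := boolp.choice sP.
have [||h hE] := @rmorphism_ext _ _ s.
- by move=> x y; apply: (fmorph_inj j); rewrite rmorphB !sE !rmorphB.
- split=> [|x y]; apply: (fmorph_inj j); first by rewrite sE !rmorph1.
  by rewrite rmorphM !sE !rmorphM.
exists h => [|y]; last by rewrite /= hE sE.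
apply: fixing_in_Gal => // y; apply: (fmorph_inj j).
by rewrite hE sE; apply: tji.
Qed.

Lemma valuation_independent_ramification_trivial (K L E : fieldType)
    (i : {rmorphism K -> L}) (e : {rmorphism L -> E})
    (G : orderedGroupType) (v : valuation E G) :
    valuation_independent i e v ->
  forall s, in_ramification_group i (vrestrict e v) s -> s =1 id.
Proof.
move=> indep s [sG s_ram]; apply: boolp.contrapT => s_id.
pose idL : {rmorphism L -> L} := idfun.
pose g (a : 'I_2) : {rmorphism L -> L} := if a == ord0 then idL else s.
pose d_ (a : 'I_2) : E := if a == ord0 then 1 else -1.
have [//|a|a b|x x0] := indep 2 d_ g.
- by rewrite /g; case: ifP => // _; split=> //; exists id.
- rewrite /g; have [->|a0] := eqVneq a ord0;
    have [->|b0] := eqVneq b ord0 => //.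
    by move=> ids; case: s_id => y; rewrite -(ids y).
  by move=> _; apply: val_inj; move: a b a0 b0 => [[|[|a]] ?] [[|[|b]] ?].
have sx_ram := s_ram x x0; pose u := e (s x / x).
have uM : u - 1 \in val_max v by rewrite -(rmorph1 e) -rmorphB.
have ex0 : e x != 0 by rewrite fmorph_eq0.
have esx : e (s x) = e x * u by rewrite -rmorphM mulrC divfK.
rewrite !big_ord_recl !big_ord0 /g /d_ /= mulr1 mulrN1 addr0 valuationN.
have vesx : v (e (s x)) = v (e x).
  by rewrite esx valuationM (one_unit_valuation uM) value_addC value_add0.
have minE a : Order.min a (@infty G) = a by apply/min_idPl; case: a.
rewrite vesx minE minxx esx -[X in X - _]mulr1 -mulrBr -opprB mulrN valuationN.
(* Independence gives [e x * (u - 1)] the value of [e x], which leaves no room for [v (u - 1)] to be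
   positive. *)
move=> vx; have : (v (u - 1) <= value0).
  rewrite -(value_leD2rE _ _ (c := v (e x))) ?valuation_neq_infty //.
  by rewrite value_add0 value_addC -valuationM vx.
by rewrite leNgt => /negP; apply.
Qed.

Theorem theorem13p2 (K L Ksep : fieldType) (Lbar : closedFieldType)
    (i : {rmorphism K -> L}) (j : {rmorphism L -> Ksep})
    (k : {rmorphism Ksep -> Lbar})
    (G : orderedGroupType) (v : valuation Lbar G)
    (hKsep : separable_closure (j \o i))
    (hLbar : algebraic_extension (k \o j))
    (hK : henselian (vrestrict (k \o j \o i) v))
    (hL : henselian (vrestrict (k \o j) v))
    (hGal : galois_extension i) :
  tame i j (vrestrict k v) <-> valuation_independent i (k \o j) v.
Proof.
have alg := hGal.1.1; split=> [tameL|indep].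
  apply: ramification_trivial_valuation_independent => // s s_ram.
  (* The two restrictions are the same function and differ only in the proofs they carry, so
     unfolding suffices. *)
  have hK' : henselian (vrestrict (j \o i) (vrestrict k v)).
    move=> F f falg G1 G2 w1 w2; exact: hK falg G1 G2 w1 w2.
  by apply: (tame_ramification_trivial hKsep hK' tameL); have [] := s_ram.
(* A ramification automorphism [t] of [Ksep] restricts to one of [L], which independence makes
   trivial; so [t] fixes [j x]. *)
split=> // x t [[t_bij tK] t_ram].
have [s sG ts] := normal_restriction hGal tK.
rewrite [LHS]ts /= (valuation_independent_ramification_trivial indep) //.
split=> // d d0; rewrite /= rmorphB fmorph_div -[j (s d)]ts rmorph1.
by apply: t_ram; rewrite fmorph_eq0.
Qed.
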